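(* If $G$ is a finite simple connected twin-free graph with at least two vertices, then $o(G\circ P_3)=\mathcal{R}$ and $R_{\rm MB}(G\circ P_3)=R_{\rm MB}'(G\circ P_3)=n(G)$.
   Context: $P_n$ is the path on $n$ vertices; $n(G)$ is the number of vertices of $G$. Vertices $u\neq v$ are twins if $N(u)\setminus\{v\}=N(v)\setminus\{u\}$; $G$ is twin-free if it has no pair of twins. The lexicographic product $G\circ H$ has vertex set $V(G)\times V(H)$, with $(g,h)(g',h')$ an edge iff $gg'\in E(G)$, or $g=g'$ and $hh'\in E(H)$. A set $W\subseteq V(X)$ is a resolving set of a connected graph $X$ if for every two distinct vertices $x,y$ there is $z\in W$ with $d(x,z)\ne d(y,z)$. In the Maker-Breaker resolving game on $X$, Resolver and Spoiler alternately select unplayed vertices of $X$; Resolver wins if the vertices he selects contain a resolving set of $X$, and Spoiler wins if she selects at least one vertex of every resolving set of $X$. The R-game has Resolver moving first; the S-game has Spoiler moving first. $o(X)=\mathcal{R}$ means Resolver has a winning strategy no matter who starts. $R_{\rm MB}(X)$ (resp. $R_{\rm MB}'(X)$) is the minimum number of moves Resolver needs to win the R-game (resp. S-game) under optimal play of both players. *)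

(* Defs.v *)
From mathcomp Require Import all_boot.
From mathcomp Require Import boolp.
Set Implicit Arguments.
Unset Strict Implicit.
Unset Printing Implicit Defensive.

Record sgraph := SGraph {
  svertex :> finType;
  sedge : rel svertex;
  sedge_sym : symmetric sedge;
  sedge_irr : irreflexive sedge
}.

Definition connected (G : sgraph) : Prop :=
  forall x y : G, connect (@sedge G) x y.

Definition nbhd (G : sgraph) (u : G) : {set G} := [set w | sedge u w].

Definition twins (G : sgraph) (u v : G) : Prop :=
  u <> v /\ nbhd u :\ v = nbhd v :\ u.

Definition twin_free (G : sgraph) : Prop := forall u v : G, ~ twins u v.

Definition path_rel (n : nat) : rel 'I_n :=
  fun i j => (i.+1 == j :> nat) || (j.+1 == i :> nat).

Lemma path_rel_sym n : symmetric (@path_rel n).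
Proof. by move=> i j; rewrite /path_rel orbC. Qed.

Lemma path_rel_irr n : irreflexive (@path_rel n).
Proof. by move=> i; rewrite /path_rel gtn_eqF. Qed.

Definition path_graph (n : nat) : sgraph :=
  SGraph (@path_rel_sym n) (@path_rel_irr n).

Definition lex_rel (G H : sgraph) : rel (G * H) :=
  fun p q => sedge p.1 q.1 || (p.1 == q.1) && sedge p.2 q.2.

Lemma lex_rel_sym G H : symmetric (@lex_rel G H).
Proof.
by move=> p q; rewrite /lex_rel sedge_sym eq_sym [X in _ && X]sedge_sym.
Qed.

Lemma lex_rel_irr G H : irreflexive (@lex_rel G H).
Proof. by move=> p; rewrite /lex_rel !sedge_irr andbF. Qed.

Definition lex_product (G H : sgraph) : sgraph :=
  SGraph (@lex_rel_sym G H) (@lex_rel_irr G H).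

Definition walk_of_length (G : sgraph) (x y : G) (n : nat) : bool :=
  [exists p : n.-tuple G, path (@sedge G) x p && (last x p == y)].

(* Least length of a walk from x to y. A shortest walk has length < #|G|, so
   the search range is exhaustive; the value is #|G| when there is no walk. *)
Definition dist (G : sgraph) (x y : G) : nat :=
  find (walk_of_length x y) (iota 0 #|G|).

Definition resolving (G : sgraph) (W : {set G}) : Prop :=
  forall x y : G, x <> y -> exists2 z, z \in W & dist x z <> dist y z.

Inductive player := Resolver | Spoiler.

Definition opponent (p : player) : player :=
  if p is Resolver then Spoiler else Resolver.

(* A history is the chronological list of all vertices selected so far by
   both players; [first] is the player who makes the first move. *)
Definition to_move (first : player) (T : Type) (h : seq T) : player :=
  if odd (size h) then opponent first else first.

Fixpoint resolver_moves (first : player) (T : Type) (h : seq T) : seq T :=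
  match h with
  | [::] => [::]
  | v :: h' =>
      let r := resolver_moves (opponent first) h' in
      if first is Resolver then v :: r else r
  end.

Definition strategy (G : sgraph) := seq G -> G.

Definition legal_strategy (G : sgraph) (s : strategy G) : Prop :=
  forall h : seq G, (exists x, x \notin h) -> s h \notin h.

(* A play is continued until every vertex is selected: as Resolver's set only
   grows, playing on after a win does not change who wins, nor when. *)
Definition complete_play (G : sgraph) (h : seq G) : Prop :=
  uniq h /\ forall x : G, x \in h.

Definition follows (G : sgraph) (first : player) (s : strategy G)
    (h : seq G) : Prop :=
  forall (h1 : seq G) (v : G) (h2 : seq G),
    h = h1 ++ v :: h2 -> to_move first h1 = Resolver -> v = s h1.

Definition contains_resolving (G : sgraph) (r : seq G) : Prop :=
  exists W : {set G}, resolving W /\ {subset W <= r}.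

Definition resolver_wins (G : sgraph) (first : player) : Prop :=
  exists s : strategy G, legal_strategy s /\
    forall h, complete_play h -> follows first s h ->
      contains_resolving (resolver_moves first h).

Definition resolver_wins_within (G : sgraph) (first : player) (k : nat) : Prop :=
  exists s : strategy G, legal_strategy s /\
    forall h, complete_play h -> follows first s h ->
      contains_resolving (take k (resolver_moves first h)).

Definition outcome_R (G : sgraph) : Prop :=
  forall first : player, resolver_wins G first.

(* None stands for infinity: Resolver cannot force a win. *)
Definition min_moves (G : sgraph) (first : player) : option nat :=
  match pselect (exists k, `[< resolver_wins_within G first k >]) with
  | left ex => Some (ex_minn ex)
  | right _ => None
  end.

Definition R_MB (G : sgraph) : option nat := min_moves G Resolver.
Definition R_MB' (G : sgraph) : option nat := min_moves G Spoiler.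

(* Main.v *)
Require Import Defs.
From mathcomp Require Import all_boot.
From mathcomp Require Import fingroup perm boolp zify.
Set Implicit Arguments.
Unset Strict Implicit.
Unset Printing Implicit Defensive.

(** In [G o P_3] the two ends of each copy of [P_3] are twins, so a resolving
    set must contain one of them. Conversely, any choice of one end per copy
    resolves everything: it separates the vertices of its own copy, and a vertex
    [w] of [G] witnessing that [g], [g'] are not twins separates the copies of
    [g] and [g'] by adjacency. Hence Resolver has to hit [n(G)] disjoint
    pairs, and wins as soon as he does. Answering each threat inside its
    pair, and otherwise playing in a fresh pair, he hits a new pair at every
    move. *)

(** * Distances *)

Lemma walk_of_length0 (G : sgraph) (x y : G) :
  walk_of_length x y 0 = (x == y).
Proof.
apply/existsP/idP => [[p]|xy]; first by rewrite (tuple0 p).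
by exists [tuple].
Qed.

Lemma walk_of_length1 (G : sgraph) (x y : G) :
  walk_of_length x y 1 = sedge x y.
Proof.
apply/existsP/idP => [[[[|z []] //= _]]|xy].
  by rewrite andbT => /andP[xz /eqP <-].
by exists [tuple y]; rewrite /= xy eqxx.
Qed.

Lemma dist_eq0 (G : sgraph) (x y : G) : (dist x y == 0) = (x == y).
Proof.
rewrite /dist; have : 0 < #|G| by apply/card_gt0P; exists x.
case: #|G| => // n _ /=; rewrite walk_of_length0.
by case: (x == y).
Qed.

Lemma dist_eq1 (G : sgraph) (x y : G) : (dist x y == 1) = sedge x y.
Proof.
have [->|xy] := eqVneq x y.
  by rewrite sedge_irr; have := dist_eq0 y y; rewrite eqxx => /eqP ->.
(* Two distinct vertices ensure that the search range of [dist] reaches length 1. *)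
have : 1 < #|G| by apply/card_gt1P; exists x, y.
rewrite /dist; case: #|G| => // -[] // n _ /=.
rewrite walk_of_length0 walk_of_length1 (negPf xy).
by case: (sedge x y).
Qed.

(** Automorphisms carry walks to walks of the same length; for an involution, the converse transfer
    is the same map applied again. *)
Lemma dist_morph (G : sgraph) (f : G -> G) (x y : G) : involutive f ->
  {mono f : u v / sedge u v} -> dist (f x) (f y) = dist x y.
Proof.
move=> fK f_edge; rewrite /dist; apply: eq_find => n.
have walk_f u v : walk_of_length u v n -> walk_of_length (f u) (f v) n.
  case/existsP=> p /andP[p_path /eqP p_last].
  apply/existsP; exists (map_tuple f p).
  rewrite last_map p_last eqxx andbT path_map.
  by rewrite (eq_path (e' := @sedge G)) // => a b /=; rewrite f_edge.
by apply/idP/idP=> /walk_f //; rewrite !fK.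
Qed.

(** The transposition of twins [u] and [v] is an involutive automorphism, and it fixes [z]. *)
Lemma twins_dist (G : sgraph) (u v z : G) :
  twins u v -> z != u -> z != v -> dist u z = dist v z.
Proof.
move=> [/eqP uv /setP tw] zu zv.
have adj w : w != u -> w != v -> sedge u w = sedge v w.
  by move=> wu wv; move: (tw w); rewrite !inE wu wv.
have <- : dist (tperm u v u) (tperm u v z) = dist u z.
  apply: dist_morph; first exact: tpermK.
  move=> a b; case: (tpermP u v a) => [->|->|/eqP au /eqP av];
    case: (tpermP u v b) => [->|->|/eqP bu /eqP bv];
    rewrite ?sedge_irr //; try by rewrite sedge_sym.
  - by rewrite adj.
  - by rewrite adj.
  - by rewrite ![sedge a _]sedge_sym adj.
  - by rewrite ![sedge a _]sedge_sym adj.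
by rewrite tpermL tpermD // eq_sym.
Qed.

Lemma resolving_twins (G : sgraph) (W : {set G}) (u v : G) :
  twins u v -> resolving W -> (u \in W) || (v \in W).
Proof.
move=> tw /(_ u v (proj1 tw)) [z zW dz].
have [<-|zu] := eqVneq z u; first by rewrite zW.
have [<-|zv] := eqVneq z v; first by rewrite zW orbT.
by case: dz; apply: twins_dist.
Qed.

(** * Plays *)

Lemma resolver_moves_rcons first (T : Type) (h : seq T) (v : T) :
  resolver_moves first (rcons h v) =
  if to_move first h is Resolver then rcons (resolver_moves first h) v
  else resolver_moves first h.
Proof.
elim: h first => [|x h IHh] [] //=; rewrite IHh /to_move /=;
  by case: (odd (size h)).
Qed.

Lemma to_move_rcons first (T : Type) (h : seq T) (v : T) :
  to_move first (rcons h v) = opponent (to_move first h).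
Proof. by rewrite /to_move size_rcons /=; case: (odd _); case: first. Qed.

Lemma size_resolver_moves first (T : Type) (h : seq T) :
  size (resolver_moves first h) =
  if first is Resolver then uphalf (size h) else half (size h).
Proof. by elim: h first => [|x h IHh] [] //=; rewrite IHh. Qed.

Lemma follows_rcons (G : sgraph) first (s : strategy G) h v :
  follows first s (rcons h v) <->
  follows first s h /\ (to_move first h = Resolver -> v = s h).
Proof.
split=> [fol|[fol vs] h1 w h2].
  split=> [h1 w h2 eh|]; last by apply: (fol h v [::]); rewrite cats1.
  by apply: (fol h1 w (rcons h2 v)); rewrite eh rcons_cat.
case/lastP: h2 => [|h2 y]; first by rewrite cats1 => /rcons_inj[<- <-].
by rewrite -rcons_cons -rcons_cat => /rcons_inj[/fol].
Qed.

Lemma complete_play_size (G : sgraph) (h : seq G) :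
  complete_play h -> size h = #|G|.
Proof.
by case=> uh allh; rewrite -(card_uniqP uh); apply: eq_card => x; rewrite allh.
Qed.

(** Winning quantifies over all plays that follow [s]; a lower bound on the number of moves needs at
    least one such play. *)
Lemma exists_complete_play (G : sgraph) first (s : strategy G) :
  legal_strategy s -> exists2 h, complete_play h & follows first s h.
Proof.
move=> legal.
have partial n : n <= #|G| ->
    exists h : seq G, [/\ uniq h, size h = n & follows first s h].
  elim: n => [_|n IHn ltn]; first by exists [::]; split=> // -[].
  have [h [uh sh fh]] := IHn (ltnW ltn).
  have fresh : exists x, x \notin h.
    apply/existsP; rewrite -negb_forall; apply/negP => /forallP allh.
    by move: ltn; rewrite -(complete_play_size (conj uh allh)) sh ltnn.
  have [x xh] := fresh.
  (* Spoiler may take any free vertex. *)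
  exists (rcons h (if to_move first h is Resolver then s h else x)).
  rewrite size_rcons sh rcons_uniq uh andbT; split=> //.
    by case: (to_move _ _); first exact: legal.
  by apply/follows_rcons; split=> // ->.
have [h [uh sh fh]] := partial _ (leqnn _).
exists h => //; split=> // x.
apply/negPn/negP => xh.
have /card_uniqP card_xh : uniq (x :: h) by rewrite /= xh.
by have := max_card (mem (x :: h)); rewrite card_xh /= sh ltnn.
Qed.

Lemma min_moves_eq (G : sgraph) first n :
  resolver_wins_within G first n ->
  (forall k, resolver_wins_within G first k -> n <= k) ->
  min_moves G first = Some n.
Proof.
move=> win lower; rewrite /min_moves.
case: pselect => [ex|[]]; last by exists n; apply/asboolP.
case: ex_minnP => m /asboolP /lower nm /(_ n (introT (asboolP _) win)) mn.
by congr Some; apply/eqP; rewrite eqn_leq mn.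
Qed.

Lemma resolver_wins_within_wins (G : sgraph) first n :
  resolver_wins_within G first n -> resolver_wins G first.
Proof.
case=> s [legal win]; exists s; split=> // h ch fh.
have [W [resW subW]] := win h ch fh.
by exists W; split=> // x /subW /mem_take.
Qed.

(** * Disjoint pairs *)

Section Pairing.

Variables (G : sgraph) (I : finType) (e : I * bool -> G).
Hypothesis e_inj : injective e.

(** The pair with index [i] consists of [e (i, true)] and [e (i, false)]. Injectivity of [e] says
    both that these differ and that distinct pairs are disjoint. *)
Definition hits (r : seq G) (i : I) := [exists b, e (i, b) \in r].

Definition flip (q : I * bool) := (q.1, ~~ q.2).

Lemma flipK : involutive flip.
Proof. by case=> i b; rewrite /flip negbK. Qed.

Lemma hits_e (r : seq G) q : e q \in r -> hits r q.1.
Proof. by case: q => i b eq_r; apply/existsP; exists b. Qed.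

Lemma hits_sub (r r' : seq G) i : {subset r <= r'} -> hits r i -> hits r' i.
Proof. by move=> sub /existsP[b /sub ?]; apply/existsP; exists b. Qed.

Lemma hits_all_size (r : seq G) : (forall i, hits r i) -> #|I| <= size r.
Proof.
(* The boolean selects the [true] member if it lies in [r] and the other one if not, so [f i] is
   always a member lying in [r]. *)
move=> all_hit; pose f i := e (i, e (i, true) \in r).
rewrite cardE -(size_map f); apply: uniq_leq_size.
  by rewrite map_inj_uniq ?enum_uniq // => i j /e_inj[].
move=> _ /mapP[i _ ->]; rewrite /f.
case: (boolP (e (i, true) \in r)) => // nt.
by have /existsP[[]] := all_hit i; rewrite ?(negPf nt).
Qed.

Lemma resolver_wins_within_lower first k :
  (forall W : {set G}, resolving W -> forall i, hits (enum W) i) ->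
  resolver_wins_within G first k -> #|I| <= k.
Proof.
move=> nec [s [legal win]].
have [h ch fh] := exists_complete_play first legal.
have [W [/nec hitW subW]] := win h ch fh.
apply: leq_trans (geq_minl k (size (resolver_moves first h))).
rewrite -size_take_min; apply: hits_all_size => i.
by apply: hits_sub (hitW i) => x; rewrite mem_enum => /subW.
Qed.

Section Strategy.

Variables (first : player) (x0 : G).

Let moves (h : seq G) := resolver_moves first h.

(** A played vertex of a pair that Resolver has not hit was taken by Spoiler, so Resolver can only
    hope for its mate. *)
Definition threatened (h : seq G) q := (e q \in h) && ~~ hits (moves h) q.1.

(** Threats come first, then unhit pairs. The last branch keeps the strategy legal, and [x0] is a
    dummy for histories that leave no vertex free. *)
Definition pairing_strategy : strategy G := fun h =>
  if [pick q | (e q \notin h) && threatened h (flip q)] is Some q then e q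
  else if [pick q | (e q \notin h) && ~~ hits (moves h) q.1] is Some q then e q
  else if [pick x | x \notin h] is Some x then x else x0.

Lemma pairing_strategy_legal : legal_strategy pairing_strategy.
Proof.
move=> h [x xh]; rewrite /pairing_strategy.
case: pickP => [q /andP[] //|_]; case: pickP => [q /andP[] //|_].
by case: pickP => [//|/(_ x)]; rewrite xh.
Qed.

Lemma pairing_strategy_threat h q :
  (forall q1 q2, threatened h q1 -> threatened h q2 -> q1 = q2) ->
  threatened h q -> pairing_strategy h = e (flip q).
Proof.
move=> one tq; rewrite /pairing_strategy; case: pickP => [p /andP[_ tp]|none].
  by rewrite (one _ _ tq tp) flipK.
(* Were the mate already played, it would be a second threat, against uniqueness. *)
have := none (flip q); rewrite flipK tq andbT => /negbFE eqh.
have := one q (flip q) tq; rewrite /threatened eqh /=.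
by case/andP: tq => _ -> /(_ isT); case: (q) => i [].
Qed.

(** Without threats, both members of an unhit pair are free, so the second branch applies. *)
Lemma pairing_strategy_fresh h i :
  (forall q, ~~ threatened h q) -> ~~ hits (moves h) i ->
  exists2 q, pairing_strategy h = e q & ~~ hits (moves h) q.1.
Proof.
move=> safe unhit; rewrite /pairing_strategy.
case: pickP => [q|_]; first by rewrite (negPf (safe _)) andbF.
case: pickP => [q /andP[_ uq]|none]; first by exists q.
have := none (i, true); rewrite unhit andbT => /negbFE eih.
by have := safe (i, true); rewrite /threatened eih unhit.
Qed.

(** The invariant of the play: each Spoiler move creates at most one threat, and Resolver removes it
    at once. *)
Lemma threatened_follows h : follows first pairing_strategy h ->
  if to_move first h is Resolver
  then forall q1 q2, threatened h q1 -> threatened h q2 -> q1 = q2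
  else forall q, ~~ threatened h q.
Proof.
elim/last_ind: h => [_|h v IHh /follows_rcons[/IHh {}IHh vs]].
  by case: to_move => [q1|q]; rewrite /threatened.
rewrite to_move_rcons.
case turn: (to_move first h) IHh vs => /= IHh vs; last first.
  (* Nothing was threatened before Spoiler's move [v], so a threat can only be [v] itself. *)
  have eqv q : threatened (rcons h v) q -> e q = v.
    rewrite /threatened /moves resolver_moves_rcons turn mem_rcons inE.
    case/andP=> /orP[/eqP //|eqh] nhit.
    by have := IHh q; rewrite /threatened eqh nhit.
  by move=> q1 q2 /eqv e1 /eqv e2; apply: e_inj; rewrite e1 e2.
move=> q; apply/negP.
rewrite /threatened /moves resolver_moves_rcons turn mem_rcons inE.
case/andP=> eq_hv nhit.
have qv : e q != v.
  by apply: contraNneq nhit => <-; apply: hits_e; rewrite mem_rcons mem_head.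
move: eq_hv; rewrite (negPf qv) /= => eqh.
(* A threat surviving Resolver's move was already there before, hence was the only one; but then the
   move was its mate. *)
have tq : threatened h q.
  rewrite /threatened eqh; apply: contra nhit.
  by apply: hits_sub => x; rewrite mem_rcons inE orbC => ->.
case/negP: nhit; apply: (hits_e (q := flip q)).
by rewrite -(pairing_strategy_threat IHh tq) -vs // mem_rcons mem_head.
Qed.

Lemma pairing_strategy_new h i : follows first pairing_strategy h ->
  to_move first h = Resolver -> ~~ hits (moves h) i ->
  exists2 q, pairing_strategy h = e q & ~~ hits (moves h) q.1.
Proof.
move=> /threatened_follows one turn nhit; rewrite turn in one.
have [q tq|safe] := pickP (threatened h).
  by exists (flip q); [exact: pairing_strategy_threat | case/andP: tq].
by apply: pairing_strategy_fresh nhit => q; rewrite safe.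
Qed.

(** Each of Resolver's first [#|I|] moves hits a new pair. The truncations by [minn] and [take] let
    the induction run on to the end of the play. *)
Lemma card_hits_follows h : follows first pairing_strategy h ->
  minn #|I| (size (moves h)) <= #|[set i | hits (take #|I| (moves h)) i]|.
Proof.
elim/last_ind: h => [|h v IHh]; first by rewrite minn0.
case/follows_rcons=> fol vs; have {}IHh := IHh fol; move: vs.
rewrite /moves resolver_moves_rcons.
case turn: (to_move first h) => // /(_ erefl) vs.
(* Once [#|I|] moves are made, a further one leaves the prefix unchanged. *)
have [le_size|lt_size] := leqP #|I| (size (moves h)).
  rewrite -cats1 takel_cat // size_cat (minn_idPl (leq_trans le_size _)).
    by move: IHh; rewrite (minn_idPl le_size).
  exact: leq_addr.
rewrite [take _ (rcons _ _)]take_oversize size_rcons //.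
move: IHh; rewrite (minn_idPr lt_size) (minn_idPr (ltnW lt_size)).
rewrite take_oversize ?(ltnW lt_size) // => IHh.
have mono i : hits (moves h) i -> hits (rcons (moves h) v) i.
  by apply: hits_sub => x; rewrite mem_rcons inE orbC => ->.
(* Fewer than [#|I|] moves cannot hit all the disjoint pairs, so some pair is still unhit. *)
have [i nhit|all_hit] := pickP (fun i => ~~ hits (moves h) i); last first.
  have := hits_all_size (fun i => negbFE (all_hit i)).
  by rewrite leqNgt lt_size.
have [q sq nq] := pairing_strategy_new fol turn nhit.
apply: leq_ltn_trans IHh _; apply: proper_card; apply/properP; split.
  by apply/subsetP => j; rewrite !inE; apply: mono.
exists q.1; rewrite !inE //; apply: hits_e.
by rewrite vs sq mem_rcons mem_head.
Qed.

End Strategy.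

Lemma resolver_wins_within_pairing first (x0 : G) :
  (forall W : {set G}, (forall i, hits (enum W) i) -> resolving W) ->
  resolver_wins_within G first #|I|.
Proof.
move=> suff.
exists (pairing_strategy first x0); split.
  exact: pairing_strategy_legal.
move=> h ch fh; exists [set x in take #|I| (resolver_moves first h)].
split; last by move=> x; rewrite inE.
apply: suff => i.
(* The disjoint pairs occupy [2 * #|I|] vertices, so even as second player Resolver gets [#|I|]
   moves in a complete play. *)
have large : #|I| <= size (resolver_moves first h).
  have : #|{: I * bool}| <= #|G| by exact: leq_card e_inj.
  rewrite card_prod card_bool size_resolver_moves (complete_play_size ch).
  by case: first {fh} => ?; lia.
have := card_hits_follows fh; rewrite (minn_idPl large) => full.
have /setP/(_ i) : [set i | hits (take #|I| (resolver_moves first h)) i] = setT.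
  by apply/eqP; rewrite eqEcard subsetT cardsT.
rewrite !inE; apply: hits_sub => x.
by rewrite mem_enum inE.
Qed.

End Pairing.

(** * Ends of the copies of [P_3] *)

Definition copy_end (G : sgraph) (q : G * bool) :
    lex_product G (path_graph 3) :=
  (q.1, if q.2 then ord0 else ord_max).

Lemma copy_end_inj (G : sgraph) : injective (@copy_end G).
Proof. by move=> [g []] [g' []] [->]. Qed.

(** Both ends see the middle of their own copy and every vertex of the neighbouring copies. *)
Lemma copy_end_twins (G : sgraph) (g : G) :
  twins (copy_end (g, true)) (copy_end (g, false)).
Proof.
split=> //; apply/setP => -[w [j lt_j]]; rewrite !inE /= /lex_rel /=.
rewrite !xpair_eqE /= [w == g]eq_sym.
have [->|] := eqVneq g w; rewrite ?sedge_irr ?andbF //=.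
by case: j lt_j => [|[|[|]]].
Qed.

Lemma resolving_hits_ends (G : sgraph)
    (W : {set lex_product G (path_graph 3)}) :
  resolving W -> forall g, hits (@copy_end G) (enum W) g.
Proof.
move=> resW g; apply/existsP.
case/orP: (resolving_twins (copy_end_twins g) resW) => gW.
  by exists true; rewrite mem_enum.
by exists false; rewrite mem_enum.
Qed.

(** As [w] differs from both [g] and [g'], adjacency in the product between its copy and theirs is
    just adjacency in [G]. *)
Lemma twin_free_witness (G : sgraph) (g g' : G) : twin_free G -> g != g' ->
  exists w, [/\ w != g, w != g' & sedge g w != sedge g' w].
Proof.
move=> Gtf gg'.
have [w /and3P[wg wg' ww]|none] := pickP
    (fun w => [&& w != g, w != g' & sedge g w != sedge g' w]).
  by exists w.
case: (Gtf g g'); split; first exact/eqP.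
apply/setP=> w; have := none w; rewrite !inE.
have [->|wg] := eqVneq w g; first by rewrite sedge_irr andbF.
have [->|wg'] := eqVneq w g'; first by rewrite sedge_irr andbF.
by move=> /= /negbFE/eqP.
Qed.

Lemma hits_ends_resolving (G : sgraph)
    (W : {set lex_product G (path_graph 3)}) : twin_free G ->
  (forall g, hits (@copy_end G) (enum W) g) -> resolving W.
Proof.
move=> Gtf hitW [g i] [g' j] /eqP xy.
have [eg|gg'] := eqVneq g g'; last first.
  have [w [wg wg' adj]] := twin_free_witness Gtf gg'.
  have /existsP[b] := hitW w; rewrite mem_enum => wW.
  exists (copy_end (w, b)) => //.
  move=> /(congr1 (fun n => n == 1)); rewrite !dist_eq1 /= /lex_rel /=.
  rewrite [g == w]eq_sym [g' == w]eq_sym (negPf wg) (negPf wg') !orbF.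
  exact/eqP.
(* Within one copy, the chosen end is at distance 0 from itself, 1 from the middle, and neither 0
   nor 1 from the other end; testing against 0 and 1 thus separates all three. *)
move: xy; rewrite -{}eg {g'} xpair_eqE eqxx /= => ij.
have /existsP[b] := hitW g; rewrite mem_enum => gW.
exists (copy_end (g, b)) => // dd.
have := congr1 (fun n => n == 0) dd; have := congr1 (fun n => n == 1) dd.
rewrite /= !dist_eq1 !dist_eq0 /= /lex_rel /= !xpair_eqE sedge_irr eqxx /=.
by case: b {gW dd} => /=;
  case: i ij => [[|[|[|i]]] lti] //; case: j => [[|[|[|j]]] ltj].
Qed.

Theorem theorem5p1 (G : sgraph) (Gconn : connected G) (Gtf : twin_free G)
    (G2 : 2 <= #|G|) :
  outcome_R (lex_product G (path_graph 3)) /\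
  R_MB (lex_product G (path_graph 3)) = Some #|G| /\
  R_MB' (lex_product G (path_graph 3)) = Some #|G|.
Proof.
have win first :
    resolver_wins_within (lex_product G (path_graph 3)) first #|G|.
  have /card_gt0P[g _] := ltnW G2.
  apply: (resolver_wins_within_pairing (@copy_end_inj G)) => [|W].
    exact: (copy_end (g, true)).
  exact: hits_ends_resolving.
have lower first k :
    resolver_wins_within (lex_product G (path_graph 3)) first k -> #|G| <= k.
  apply: (resolver_wins_within_lower (@copy_end_inj G)) => W.
  exact: resolving_hits_ends.
split; first by move=> first; exact: resolver_wins_within_wins (win first).
by split; apply: min_moves_eq => //; apply: lower.
Qed.
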